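(* Let $0<p<\infty$, let $u,v:\mathbb{R}_+\to\mathbb{R}_+$ be two weights, and assume that $u$ is a decreasing function. Then $\Lambda_2^p(uv)\subset\Lambda^p(u)[\Lambda^p(v)]$.
   Context: $\mathbb{R}_+=(0,\infty)$ as the domain of weights; a weight is a non-negative locally integrable function. ''Decreasing'' means non-increasing. For a measurable function $h$ on $\mathbb{R}$, $h^*(t)=\inf\{\sigma:|\{x:|h(x)|>\sigma\}|\le t\}$, $t>0$. For measurable $f:\mathbb{R}^2\to\mathbb{R}$, written $f(x,y)$, $f_y^*(x,t)$ is the decreasing rearrangement of $f(x,\cdot)$ evaluated at $t$ (with $x$ fixed), a subscript $x$ on a star denotes the decreasing rearrangement with respect to the first variable, and $f^*_{yx}(s,t)=(f_y^*(\cdot,t))^*_x(s)$. $\Lambda_2^p(uv)$ is the set of measurable $f:\mathbb{R}^2\to\mathbb{R}$ with $\|f\|_{\Lambda_2^p(uv)}=\left(\int_0^\infty\int_0^\infty(f^*_{yx}(s,t))^pu(s)v(t)\,ds\,dt\right)^{1/p}<\infty$. $\Lambda^p(u)[\Lambda^p(v)]$ is the set of measurable $f:\mathbb{R}^2\to\mathbb{R}$ with $$\|f\|_{\Lambda^p(u)[\Lambda^p(v)]}=\left(\int_0^\infty\left(\int_0^\infty(f_y^*(\cdot,t))^pv(t)\,dt\right)^*_x(s)\,u(s)\,ds\right)^{1/p}<\infty.$$ *)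

(* Defs.v *)
From mathcomp Require Import all_boot all_order all_algebra.
From mathcomp Require Import all_classical all_reals all_analysis.
From mathcomp Require Import measurable_realfun.

Set Implicit Arguments.
Unset Strict Implicit.
Unset Printing Implicit Defensive.

Import Order.TTheory GRing.Theory Num.Theory.
Import numFieldNormedType.Exports.

Local Open Scope classical_set_scope.
Local Open Scope ring_scope.
Local Open Scope ereal_scope.
Local Open Scope measure_scope.

(* "Measurable" means Lebesgue measurable throughout: one-dimensional measures
   and integrals are taken with respect to [completed_lebesgue_measure], and
   measurability on the plane refers to the completion of the Borel sets for
   the product measure. *)

(* The real line with the sigma-algebra of Lebesgue measurable sets. *)
Notation lebesgueType R := (caratheodory_type (@wlength R idfun)^*%mu).

Definition pos_reals (R : realType) : set (lebesgueType R) :=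
  [set x : R | (0 < x)%R].
Arguments pos_reals : clear implicits.

Definition lebesgue_measurable2 (R : realType) (f : R * R -> R) :=
  forall B : set R, measurable B ->
    completed_algebra_gen (@lebesgue_measure R \x @lebesgue_measure R)
      (f @^-1` B).

(* A weight on (0, +oo) is a total function whose values outside (0, +oo) are
   irrelevant; local integrability concerns the compact subsets of the open
   half-line, so there may be a singularity at 0. *)
Definition weight (R : realType) (w : R -> R) :=
  let mu := @completed_lebesgue_measure R in
  [/\ measurable_fun (pos_reals R) (w : lebesgueType R -> R),
      forall x : R, (0 < x -> 0 <= w x)%R &
      forall K : set R, K `<=` pos_reals R -> compact K ->
        \int[mu]_(x in K) `|w x|%:E < +oo].

(* The argument may take infinite values, because [rearr] is iterated below;
   the infimum of the empty set is +oo. *)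
Definition rearr (R : realType) (h : R -> \bar R) (t : R) : \bar R :=
  ereal_inf [set sigma%:E | sigma in [set sigma : R |
    completed_lebesgue_measure [set x | sigma%:E < `|h x|] <= t%:E]].

Definition rearr_y (R : realType) (f : R * R -> R) (x t : R) : \bar R :=
  rearr (fun y => (f (x, y))%:E) t.

Definition rearr_yx (R : realType) (f : R * R -> R) (s t : R) : \bar R :=
  rearr (fun x => rearr_y f x t) s.

Definition norm_Lambda2 (R : realType) (p : R) (u v : R -> R)
    (f : R * R -> R) : \bar R :=
  let mu := @completed_lebesgue_measure R in
  (\int[mu]_(t in pos_reals R) \int[mu]_(s in pos_reals R)
     (rearr_yx f s t `^ p * (u s)%:E * (v t)%:E)) `^ p^-1.

Definition norm_Lambda_iter (R : realType) (p : R) (u v : R -> R)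
    (f : R * R -> R) : \bar R :=
  let mu := @completed_lebesgue_measure R in
  (\int[mu]_(s in pos_reals R)
     (rearr (fun x : R => \int[mu]_(t in pos_reals R)
                            (rearr_y f x t `^ p * (v t)%:E)) s
      * (u s)%:E)) `^ p^-1.

Definition Lambda2 (R : realType) (p : R) (u v : R -> R) : set (R * R -> R) :=
  [set f | lebesgue_measurable2 f /\ norm_Lambda2 p u v f < +oo].

Definition Lambda_iter (R : realType) (p : R) (u v : R -> R) :
    set (R * R -> R) :=
  [set f | lebesgue_measurable2 f /\ norm_Lambda_iter p u v f < +oo].

(* Main.v *)
Require Import Defs.
From mathcomp Require Import all_boot all_order all_algebra.
From mathcomp Require Import all_classical all_reals all_analysis.
From mathcomp Require Import measurable_realfun.

(** The inclusion holds because of the norm inequality obtained by comparing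
    the two integrals without the outer power [1/p]. Powers commute with
    rearrangement ([rearr_poweR]), so with [g (x, t)] the [p]-th power of the
    rearrangement of [f (x, _)] at [t], the claim is
      [\int rearr (fun x => \int g (x, t) v t dt) s * u s ds
         <= \int v t * (\int rearr (g (_, t)) s * u s ds) dt],
    the Minkowski inequality, in integral form, for the functional
    [h |-> \int rearr h s * u s ds] attached to a decreasing [u].

    Since [u] is decreasing, its superlevel sets are initial segments [S] of
    the half-line. Writing [u s] as the length of the set of levels below it
    and applying Tonelli's theorem reduces the claim to the unweighted
    integrals over such an [S] ([weighted_rearr_minkowski]).

    For an initial segment the functional [\int_S rearr h] is the K-functional
    between the integral and the supremum norm: [h <= c + X] implies
    [\int_S rearr h <= c |S| + \int X] ([integral_rearr_le_add]), and equality
    is attained by [c = inf_S rearr h], [X = (h - c)^+]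
    ([excess_inf_le_integral_rearr]). Both rest on equimeasurability,
    [\int rearr X = \int X] ([integral_rearr]). Integrating the optimal
    decompositions of [g (_, t)] against [v t dt] decomposes
    [\int g (_, t) v t dt], which gives the inequality over [S]
    ([integral_rearr_minkowski]).

    Measurability in the parameters comes from the fact that a rearrangement is
    an infimum over rational levels ([rearr_rat]). A Lebesgue measurable [f] on
    the plane has arbitrary sections on a null set of [x]; replacing, for each
    rational level, the superlevel set of [|f|] by a Borel set that differs from
    it by a null set yields a jointly measurable version of [g]
    ([rearr_y_rat]), and rearrangements do not see null sets ([rearr_ae]). *)

Set Implicit Arguments.
Unset Strict Implicit.
Unset Printing Implicit Defensive.

Import Order.TTheory GRing.Theory Num.Theory.
Import numFieldNormedType.Exports.

Local Open Scope classical_set_scope.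
Local Open Scope ring_scope.
Local Open Scope ereal_scope.

(** * Lebesgue measure on the line *)

Local Notation leb := (@completed_lebesgue_measure _).

Lemma borel_lebesgue_measurable (R : realType) (A : set (measurableTypeR R)) :
  measurable A -> measurable (A : set (lebesgueType R)).
Proof. exact: sub_caratheodory. Qed.

(** The measure is the outer measure itself, so it is monotone on all sets. *)
Lemma le_leb (R : realType) (A B : set R) : A `<=` B -> leb A <= leb B.
Proof. exact: (le_outer_measure ((wlength idfun)^*)%mu). Qed.

Lemma leb_setU_le (R : realType) (A B : set R) :
  leb (A `|` B) <= leb A + leb B.
Proof. exact: (outer_measureU2 ((wlength idfun)^*)%mu). Qed.

(** No measurability is involved: null sets are those of outer measure 0. *)
Lemma eq_leb_off_null (R : realType) (A B M : set R) : leb M = 0 ->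
  (forall y, ~ M y -> A y <-> B y) -> leb A = leb B.
Proof.
move=> M0; suff main (C D : set R) : (forall y, ~ M y -> C y <-> D y) ->
    leb C <= leb D.
  move=> AB; apply/eqP; rewrite eq_le !main// => y nMy.
  by split=> /(AB y nMy).
move=> CD; rewrite -[leRHS]add0e -[X in X + _]M0.
apply: le_trans (leb_setU_le _ _); apply: le_leb => y Cy.
by have [My|nMy] := pselect (M y); [left|right; apply/CD].
Qed.

Lemma leb_itv (R : realType) (i : interval R) :
  leb ([set` i] : set R) = @lebesgue_measure R [set` i].
Proof. by []. Qed.

Lemma measurable_pos_reals (R : realType) : measurable (pos_reals R).
Proof.
apply: borel_lebesgue_measurable.
have -> : pos_reals R = `]0%R, +oo[%classic :> set R.
  by apply/seteqP; split => x; rewrite /= in_itv/= andbT.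
exact: measurable_itv.
Qed.

Lemma measurable_lebesgue_EFin (R : realType) :
  measurable_fun [set: lebesgueType R] (fun x : lebesgueType R => (x : R)%:E).
Proof.
move=> _ B mB; rewrite setTI; apply: borel_lebesgue_measurable.
rewrite -[X in measurable X]setTI.
exact: (@EFin_measurable R setT measurableT B mB).
Qed.

(** Layer cake at one point: an extended nonnegative number is the length of
    the set of positive levels below it, whether or not the number itself is
    counted as a level. *)
Lemma leb_levels_lt (R : realType) (a : \bar R) : 0 <= a ->
  leb [set l : R | (0 < l)%R /\ l%:E < a] = a.
Proof.
case: a => [a| |] //.
- rewrite lee_fin => a0.
  have -> : [set l : R | (0 < l)%R /\ l%:E < a%:E] = `]0%R, a[%classic.
    by apply/seteqP; split => l; rewrite /= in_itv/= lte_fin => /andP.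
  rewrite leb_itv lebesgue_measure_itv /= lte_fin.
  have [_|a_le0] := ltP 0%R a; first by rewrite sube0.
  by apply/eqP; rewrite eq_le !lee_fin a0 a_le0.
- move=> _.
  have -> : [set l : R | (0 < l)%R /\ l%:E < +oo] = `]0%R, +oo[%classic.
    by apply/seteqP; split => l; rewrite /= in_itv/= andbT ?ltry => // -[].
  by rewrite leb_itv lebesgue_measure_itv /= ltry.
Qed.

Lemma leb_levels_le (R : realType) (a : \bar R) : 0 <= a ->
  leb [set l : R | (0 < l)%R /\ l%:E <= a] = a.
Proof.
case: a => [a| |] //.
- rewrite lee_fin => a0.
  have -> : [set l : R | (0 < l)%R /\ l%:E <= a%:E] = `]0%R, a]%classic.
    by apply/seteqP; split => l; rewrite /= in_itv/= lee_fin => /andP.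
  rewrite leb_itv lebesgue_measure_itv /= lte_fin.
  have [_|a_le0] := ltP 0%R a; first by rewrite sube0.
  by apply/eqP; rewrite eq_le !lee_fin a0 a_le0.
- move=> _.
  have -> : [set l : R | (0 < l)%R /\ l%:E <= +oo] = `]0%R, +oo[%classic.
    by apply/seteqP; split => l; rewrite /= in_itv/= andbT ?leey => // -[].
  by rewrite leb_itv lebesgue_measure_itv /= ltry.
Qed.

Lemma lebT (R : realType) : leb [set: R] = +oo :> \bar R.
Proof.
apply/eqP; rewrite -leye_eq -[X in X <= _](@leb_levels_lt R +oo)//.
exact: le_leb.
Qed.

(** * Elementary properties of the rearrangement *)

Section rearrangement.
Context {R : realType}.
Implicit Types (h : R -> \bar R) (s t : R).

Lemma rearr_le h t (l : R) :
  leb [set x | l%:E < `|h x|] <= t%:E -> rearr h t <= l%:E.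
Proof. by move=> hl; apply: ereal_inf_lbound; exists l. Qed.

Lemma rearr_ltP h t (c : \bar R) : rearr h t < c ->
  exists2 l : R, l%:E < c & leb [set x | l%:E < `|h x|] <= t%:E.
Proof. by move/ereal_inf_lt => [_ [l ll <-] lc]; exists l. Qed.

Lemma le_rearr h t (c : \bar R) :
  (forall l : R, leb [set x | l%:E < `|h x|] <= t%:E -> c <= l%:E) ->
  c <= rearr h t.
Proof. by move=> H; apply: le_ereal_inf_tmp => _ [l ll <-]; exact: H. Qed.

(** No negative level is admissible, as its superlevel set is the whole line. *)
Lemma rearr_ge0 h t : 0 <= rearr h t.
Proof.
apply: le_rearr => l; apply: contraTT; rewrite -!ltNge => l0.
suff -> : [set x | l%:E < `|h x|] = setT by rewrite lebT ltry.
by apply/seteqP; split => // x _ /=; rewrite (lt_le_trans l0).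
Qed.

Lemma rearr_homo h k t : (forall x, `|h x| <= `|k x|) -> rearr h t <= rearr k t.
Proof.
move=> hk; apply: le_rearr => l ll; apply: rearr_le.
by rewrite (le_trans _ ll)//; apply: le_leb => x /= /lt_le_trans; exact.
Qed.

Lemma rearr_ae h k (E : set R) t : leb E = 0 ->
  (forall x, ~ E x -> h x = k x) -> rearr h t = rearr k t.
Proof.
move=> E0 hk.
suff dE l : leb [set x | l%:E < `|h x|] = leb [set x | l%:E < `|k x|].
  by rewrite /rearr; congr (ereal_inf _); apply/seteqP;
    split => _ [l /= ll <-]; exists l => //=; rewrite ?dE// -dE.
by apply: (eq_leb_off_null E0) => x nEx /=; rewrite hk.
Qed.

Lemma rearr_poweR_le h p t : (0 < p)%R -> (forall x, 0 <= h x) ->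
  rearr h t `^ p <= rearr (fun x => h x `^ p) t.
Proof.
move=> p0 h0; apply: le_rearr => l ll.
have l0 : (0 <= l)%R.
  rewrite -lee_fin; apply: le_trans (rearr_le ll); exact: rearr_ge0.
have -> : l%:E = (l `^ p^-1)%:E `^ p.
  by rewrite poweR_EFin -powRrM mulVf ?gt_eqF// powRr1.
apply: gt0_ler_poweR.
- exact: ltW.
- by rewrite in_itv/= rearr_ge0 leey.
- by rewrite in_itv/= lee_fin powR_ge0 leey.
apply: rearr_le; apply: le_trans ll; apply: le_leb => x /=.
rewrite !gee0_abs ?poweR_ge0// => lx; rewrite ltNge; apply/negP => hx.
move: lx; rewrite ltNge => /negP; apply.
have -> : h x = (h x `^ p) `^ p^-1.
  by rewrite -poweRrM mulfV ?gt_eqF// poweRe1.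
rewrite -poweR_EFin; apply: gt0_ler_poweR => //.
- by rewrite invr_ge0 ltW.
- by rewrite in_itv/= poweR_ge0 leey.
- by rewrite in_itv/= lee_fin l0 leey.
Qed.

Lemma rearr_poweR h p t : (0 < p)%R -> (forall x, 0 <= h x) ->
  rearr (fun x => h x `^ p) t = rearr h t `^ p.
Proof.
move=> p0 h0; apply/eqP; rewrite eq_le rearr_poweR_le// andbT.
have pN0 : p != 0%R by rewrite gt_eqF.
(* The converse is the same inequality for [h `^ p] and the exponent [1/p]. *)
rewrite -[X in X <= _]poweRe1 ?rearr_ge0// -(mulVf pN0) poweRrM.
apply: gt0_ler_poweR.
- exact: ltW.
- by rewrite in_itv/= poweR_ge0 leey.
- by rewrite in_itv/= rearr_ge0 leey.
apply: (le_trans (rearr_poweR_le _ _ _)); rewrite ?invr_gt0//.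
  by move=> x; exact: poweR_ge0.
apply: rearr_homo => x.
by rewrite -poweRrM mulfV// poweRe1.
Qed.

Lemma rearr_le_add h X (c : \bar R) t : 0 <= c -> (forall x, 0 <= h x) ->
  (forall x, 0 <= X x) -> (forall x, h x <= c + X x) ->
  rearr h t <= c + rearr X t.
Proof.
move=> + h0 X0; case: c => [c| |] // c0 hX; last first.
  by rewrite addye ?leey// gt_eqF// (lt_le_trans _ (rearr_ge0 _ _)).
rewrite -leeBlDl//; apply: le_rearr => l ll.
rewrite leeBlDl//; apply: rearr_le.
apply: le_trans ll; apply: le_leb => x /=.
rewrite !gee0_abs// => lx; have := lt_le_trans lx (hX x).
by rewrite EFinD lteD2lE.
Qed.

End rearrangement.

(** * Measurability of the rearrangement *)

(** An enumeration of the rational levels; indices that encode no rational give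
    the level 0. *)
Definition rat_level (R : realType) (n : nat) : R :=
  ratr (odflt 0%Q (unpickle n)).

Lemma rat_level_dense (R : realType) (a b : \bar R) : a < b ->
  exists n, a <= (@rat_level R n)%:E < b.
Proof.
move=> ab.
have [q aq qb] : exists2 q : rat, a <= (ratr q : R)%:E & (ratr q : R)%:E < b.
  move: a b ab => [a| |] [b| |] //.
  - rewrite lte_fin => /rat_in_itvoo[q]; rewrite in_itv/= => /andP[aq qb].
    by exists q; rewrite ?lte_fin// lee_fin ltW.
  - move=> _; have /rat_in_itvoo[q] : (a < a + 1)%R by rewrite ltrDl.
    by rewrite in_itv/= => /andP[aq _]; exists q; rewrite ?ltry// lee_fin ltW.
  - move=> _; have /rat_in_itvoo[q] : (b - 1 < b)%R by rewrite ltrBlDr ltrDl.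
    by rewrite in_itv/= => /andP[_ qb]; exists q; rewrite ?lte_fin// leNye.
  - by move=> _; exists 0%R; rewrite ?ltry// leNye.
by exists (pickle q); rewrite /rat_level pickleK /= aq.
Qed.

(** The rearrangement at [t], computed from the values [m] of the distribution
    function at the rational levels only. *)
Definition rat_rearr (R : realType) (m : nat -> \bar R) (t : R) : \bar R :=
  einfs (fun n => if m n <= t%:E then (rat_level R n)%:E else +oo) 0%N.

Lemma rearr_rat (R : realType) (h : R -> \bar R) (t : R) :
  rearr h t = rat_rearr (fun n => leb [set x | (rat_level R n)%:E < `|h x|]) t.
Proof.
apply/eqP; rewrite eq_le; apply/andP; split.
  apply: le_ereal_inf_tmp => _ [n /= _ <-]; case: ifPn => [|_]; last exact: leey.
  exact: rearr_le.
rewrite leNgt; apply/negP => /rearr_ltP[l lc ll].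
have [n /andP[ln]] := rat_level_dense lc; rewrite ltNge => /negP; apply.
apply: ereal_inf_lbound; exists n => //=.
rewrite ifT// (le_trans _ ll)//; apply: le_leb => x /=.
exact: le_lt_trans.
Qed.

Lemma rat_rearr_decr (R : realType) (m : nat -> \bar R) (s t : R) :
  (s <= t)%R -> rat_rearr m t <= rat_rearr m s.
Proof.
move=> st; apply: le_ereal_inf_tmp => _ [n /= _ <-].
case: ifPn => [mn|_]; last exact: leey.
apply: ereal_inf_lbound; exists n => //=.
by rewrite ifT// (le_trans mn).
Qed.

Lemma measurable_rat_rearr d (Z : measurableType d) (R : realType)
    (m : nat -> Z -> \bar R) : (forall n, measurable_fun setT (m n)) ->
  measurable_fun [set: Z * lebesgueType R]
    (fun zt : Z * lebesgueType R => rat_rearr (m^~ zt.1) zt.2).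
Proof.
move=> mm.
apply: (@measurable_fun_einfs _ _ _ _ (fun n (zt : Z * lebesgueType R) =>
  if m n zt.1 <= (zt.2 : R)%:E then (rat_level R n)%:E else +oo)) => n.
apply: measurable_fun_ifT; [|exact: measurable_cst|exact: measurable_cst].
apply: measurable_fun_lee; first exact: measurableT_comp.
exact: (measurableT_comp (@measurable_lebesgue_EFin R)).
Qed.

Lemma measurable_rearr_parametric d (Z : measurableType d) (R : realType)
    (H : Z -> R -> \bar R) :
  (forall l : R, measurable_fun setT (fun z => leb [set x | l%:E < `|H z x|])) ->
  measurable_fun [set: Z * lebesgueType R]
    (fun zt : Z * lebesgueType R => rearr (H zt.1) zt.2).
Proof.
move=> mH; under eq_fun do rewrite rearr_rat.
exact: (measurable_rat_rearr (fun n => mH (rat_level R n))).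
Qed.

Lemma measurable_rearr (R : realType) (h : R -> \bar R) :
  measurable_fun [set: lebesgueType R]
    (fun t : lebesgueType R => rearr h (t : R)).
Proof.
have /= := @measurable_rearr_parametric _ unit R (fun _ => h)
  (fun l => @measurable_cst _ _ _ _ _ _).
move=> /measurableT_comp/(_ (pair1_measurable tt)); exact.
Qed.

Lemma measurable_section_distr d (Z : measurableType d) (R : realType)
    (g : lebesgueType R * Z -> \bar R) (l : R) : measurable_fun setT g ->
  measurable_fun setT (fun z : Z => leb [set x : R | l%:E < `|g (x, z)|]).
Proof.
move=> mg; pose A := [set w | l%:E < `|g w|].
have mA : measurable A.
  rewrite -[A]setTI; apply: measurable_lte.
  - exact: measurableT.
  - exact: measurable_cst.
  exact: (measurableT_comp (@abse_measurable R setT) mg).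
have -> : (fun z : Z => leb [set x : R | l%:E < `|g (x, z)|]) =
    @completed_lebesgue_measure R \o ysection A.
  by apply/funext => z /=; congr (leb _); apply/seteqP; split => x /=;
    rewrite /ysection/= ?inE.
exact: measurable_fun_ysection.
Qed.

(** * Layer cake *)

Section layer_cake.
Context d (T : measurableType d) (R : realType).
Variables (m : {sigma_finite_measure set T -> \bar R}) (X : T -> \bar R).
Hypotheses (mX : measurable_fun setT X) (X0 : forall x, 0 <= X x).

Let mX1 : measurable_fun [set: T * lebesgueType R] (X \o fst).
Proof. exact: measurableT_comp. Qed.

Let mE2 : measurable_fun [set: T * lebesgueType R]
  (fun w : T * lebesgueType R => (w.2 : R)%:E).
Proof. exact: (measurableT_comp (@measurable_lebesgue_EFin R)). Qed.

Let mpos : measurable [set w : T * lebesgueType R | 0 < (w.2 : R)%:E].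
Proof.
rewrite -[X in measurable X]setTI; apply: measurable_lte.
- exact: measurableT.
- exact: measurable_cst.
- exact: mE2.
Qed.

Let A_lt :=
  [set w : T * lebesgueType R | (0 < (w.2 : R))%R /\ (w.2 : R)%:E < X w.1].

Let mA_lt : measurable A_lt.
Proof.
apply: measurableI => //; rewrite -[X in measurable X]setTI.
exact: (measurable_lte measurableT mE2 mX1).
Qed.

Let ysection_lt : m \o ysection A_lt =
  fun l : lebesgueType R => m [set x | (0 < (l : R))%R /\ (l : R)%:E < X x].
Proof.
apply/funext => l /=; congr (m _).
by apply/seteqP; split => x /=; rewrite /ysection/= ?inE.
Qed.

Lemma measurable_layer_lt : measurable_fun [set: lebesgueType R]
  (fun l => m [set x | (0 < (l : R))%R /\ (l : R)%:E < X x]).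
Proof. by rewrite -ysection_lt; exact: measurable_fun_ysection. Qed.

Lemma layer_cake_lt : \int[m]_x X x =
  \int[leb]_(l in [set: lebesgueType R])
    m [set x | (0 < (l : R))%R /\ (l : R)%:E < X x].
Proof.
rewrite -ysection_lt -indic_fubini_tonelli_GE//.
rewrite -(indic_fubini_tonelli m (@completed_lebesgue_measure R) mA_lt).
rewrite indic_fubini_tonelli_FE//=; apply: eq_integral => x _.
rewrite -[LHS]leb_levels_lt//; congr (leb _).
by apply/seteqP; split => l /=; rewrite /xsection/= ?inE.
Qed.

Let A_le :=
  [set w : T * lebesgueType R | (0 < (w.2 : R))%R /\ (w.2 : R)%:E <= X w.1].

Let mA_le : measurable A_le.
Proof.
apply: measurableI => //; rewrite -[X in measurable X]setTI.
exact: (measurable_lee measurableT mE2 mX1).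
Qed.

Let ysection_le : m \o ysection A_le =
  fun l : lebesgueType R => m [set x | (0 < (l : R))%R /\ (l : R)%:E <= X x].
Proof.
apply/funext => l /=; congr (m _).
by apply/seteqP; split => x /=; rewrite /ysection/= ?inE.
Qed.

Lemma measurable_layer_le : measurable_fun [set: lebesgueType R]
  (fun l => m [set x | (0 < (l : R))%R /\ (l : R)%:E <= X x]).
Proof. by rewrite -ysection_le; exact: measurable_fun_ysection. Qed.

Lemma layer_cake_le : \int[m]_x X x =
  \int[leb]_(l in [set: lebesgueType R])
    m [set x | (0 < (l : R))%R /\ (l : R)%:E <= X x].
Proof.
rewrite -ysection_le -indic_fubini_tonelli_GE//.
rewrite -(indic_fubini_tonelli m (@completed_lebesgue_measure R) mA_le).
rewrite indic_fubini_tonelli_FE//=; apply: eq_integral => x _.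
rewrite -[LHS]leb_levels_le//; congr (leb _).
by apply/seteqP; split => l /=; rewrite /xsection/= ?inE.
Qed.

End layer_cake.

(** * Equimeasurability *)

Section equimeasurability.
Context {R : realType}.
Implicit Types X : lebesgueType R -> \bar R.

Lemma measurable_rearr_within (D : set (lebesgueType R)) (h : R -> \bar R) :
  measurable_fun D (fun s : lebesgueType R => rearr h s).
Proof. exact: measurable_funTS (measurable_rearr h). Qed.

Lemma restrict_rearr_ge0 (h : R -> \bar R) (s : lebesgueType R) :
  0 <= ((fun s : lebesgueType R => rearr h s) \_ (pos_reals R)) s.
Proof. by rewrite patchE; case: ifP => // _; exact: rearr_ge0. Qed.

Lemma measurable_restrict_rearr (h : R -> \bar R) :
  measurable_fun setT ((fun s : lebesgueType R => rearr h s) \_ (pos_reals R)).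
Proof.
apply/(measurable_restrictT _ (@measurable_pos_reals R)).
exact: measurable_rearr_within.
Qed.

(** A function and its rearrangement have the same distribution function, hence
    the same integral. At a level [l] the rearrangement exceeds [l] only to the
    left of [leb [set x | l%:E < X x]], and is at least [l] there; the two layer
    cake formulas, with strict and with large inequalities, absorb the possible
    difference between the two. *)
Lemma integral_rearr X : measurable_fun setT X -> (forall x, 0 <= X x) ->
  \int[leb]_(s in pos_reals R) rearr X s = \int[leb]_x X x.
Proof.
move=> mX X0; have mr := measurable_restrict_rearr X.
have r0 := restrict_rearr_ge0 X.
rewrite integral_mkcond; apply/eqP; rewrite eq_le; apply/andP; split.
  rewrite (layer_cake_lt _ mr r0) (layer_cake_lt _ mX X0).
  apply: ge0_le_integral.
  - exact: measurableT.
  - by move=> l _; exact: measure_ge0.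
  - exact: measurable_layer_lt.
  - exact: measurable_layer_lt.
  move=> l _.
  have [l0|l0] := ltP 0%R (l : R); last first.
    by rewrite (_ : [set s | _] = set0) ?measure0//; apply/seteqP; split => s // -[].
  rewrite -[X in _ <= X]leb_levels_lt//; apply: le_leb => s [_].
  rewrite patchE; case: ifPn; last by rewrite lte_fin ltNge ltW.
  rewrite inE => s0 ls; split => //.
  rewrite ltNge; apply/negP => dl; move: ls; rewrite ltNge => /negP; apply.
  apply: rearr_le; apply: le_trans dl; apply: le_leb => x /=.
  by rewrite gee0_abs.
rewrite (layer_cake_le _ mr r0) (layer_cake_lt _ mX X0).
apply: ge0_le_integral.
- exact: measurableT.
- by move=> l _; exact: measure_ge0.
- exact: measurable_layer_lt.
- exact: measurable_layer_le.
move=> l _.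
have [l0|l0] := ltP 0%R (l : R); last first.
  by rewrite (_ : [set s | _] = set0) ?measure0//; apply/seteqP; split => s // -[].
rewrite -[X in X <= _]leb_levels_lt//; apply: le_leb => s [s0 sl]; split => //.
rewrite patchE ifT ?inE//; apply: le_rearr => k kl; rewrite leNgt; apply/negP.
rewrite lte_fin => kl0; move: sl; rewrite ltNge => /negP; apply.
apply: le_trans kl; apply: le_leb => x [_ lx] /=.
by rewrite gee0_abs// (lt_trans _ lx)// lte_fin.
Qed.

End equimeasurability.

(** * The K-functional on an initial segment *)

Section initial_segment.
Context {R : realType}.
Local Notation L := (lebesgueType R).

Lemma measurable_decreasing (f : R -> \bar R) :
  (forall s t : R, (s <= t)%R -> f t <= f s) ->
  measurable_fun [set: L] (f : L -> \bar R).
Proof.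
move=> fd; apply: (measurability _ (ErealGenOInfty.measurableE R)) => //.
move=> /= _ [_ [a ->] <-]; rewrite setTI preimage_itvoy.
apply: borel_lebesgue_measurable; apply: is_interval_measurable.
move=> x y /= _ ay z /andP[_ zy].
exact: lt_le_trans ay (fd _ _ zy).
Qed.

(** The part of [b] above [c]; it vanishes at [c = +oo]. *)
Definition excess (c b : \bar R) : \bar R := maxe (b - c) 0.

Lemma excess_ge0 (c b : \bar R) : 0 <= excess c b.
Proof. by rewrite /excess le_max lexx orbT. Qed.

Lemma le_add_excess (c b : \bar R) : 0 <= c -> b <= c + excess c b.
Proof.
case: c => [c| |]// c0; last first.
  by rewrite addye ?leey// gt_eqF// (lt_le_trans _ (excess_ge0 _ _)).
by rewrite -leeBlDl// /excess le_max lexx.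
Qed.

Lemma excess_pinfty (b : \bar R) : excess +oo b = 0.
Proof. by rewrite /excess; case: b => [b| |] /=; apply/max_idPr; rewrite leNye. Qed.

Lemma lt_excess (c l : R) (b : \bar R) : (0 <= l)%R ->
  l%:E < excess c%:E b -> (l + c)%:E < b.
Proof.
move=> l0; rewrite /excess lt_max => /orP[|]; last first.
  by rewrite lte_fin ltNge l0.
by rewrite EFinD lteBrDr.
Qed.

Lemma measurable_excess d (T : measurableType d) (c b : T -> \bar R) :
  measurable_fun setT c -> measurable_fun setT b ->
  measurable_fun setT (fun x => excess (c x) (b x)).
Proof.
move=> mc mb; apply: measurable_maxe; last exact: measurable_cst.
exact: emeasurable_funB.
Qed.

(** From here on [S] is an interval of the half-line with left endpoint 0,
    possibly empty or unbounded. *)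
Variable S : set L.
Hypotheses (mS : measurable S) (S_pos : S `<=` pos_reals R).
Hypothesis S_init : forall s t : R, (0 < s)%R -> (s <= t)%R -> S t -> S s.

(** Every decomposition [h <= c + X] bounds the integral of the rearrangement. *)
Lemma integral_rearr_le_add (h X : L -> \bar R) (c : \bar R) :
  0 <= c -> measurable_fun setT X -> (forall x, 0 <= X x) ->
  (forall x, 0 <= h x) -> (forall x, h x <= c + X x) ->
  \int[leb]_(s in S) rearr h s <= c * leb S + \int[leb]_x X x.
Proof.
move=> c0 mX X0 h0 hX.
have mr (k : R -> \bar R) : measurable_fun S (fun s : L => rearr k s).
  exact: measurable_rearr_within.
apply: (@le_trans _ _ (\int[leb]_(s in S) (cst c s + rearr X s))).
  apply: ge0_le_integral.
  - exact: mS.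
  - by move=> s _; exact: rearr_ge0.
  - exact: mr.
  - by apply: emeasurable_funD; [exact: measurable_cst|exact: mr].
  - by move=> s _; exact: rearr_le_add.
rewrite ge0_integralD; first last.
- exact: mr.
- by move=> s _; exact: rearr_ge0.
- exact: measurable_cst.
- by move=> s _; exact: c0.
- exact: mS.
rewrite integral_cst; last exact: mS.
apply: leeD2l; rewrite -(integral_rearr mX X0).
apply: ge0_subset_integral.
- exact: mS.
- exact: measurable_pos_reals.
- exact: measurable_rearr_within.
- by move=> s _; exact: rearr_ge0.
- exact: S_pos.
Qed.

(** The bound of [integral_rearr_le_add] is attained when [h] is cut at the
    infimum of its rearrangement over [S]. *)
Lemma excess_inf_le_integral_rearr (g : L -> \bar R)
    (c := ereal_inf [set rearr g s | s in S]) :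
  measurable_fun setT g -> (forall x, 0 <= g x) ->
  c * leb S + \int[leb]_x excess c (g x) <= \int[leb]_(s in S) rearr g s.
Proof.
move=> mg g0.
have c0 : 0 <= c by apply: le_ereal_inf_tmp => _ [s _ <-]; exact: rearr_ge0.
have cle s : S s -> c <= rearr g s by move=> Ss; apply: ereal_inf_lbound; exists s.
have mr (h : R -> \bar R) : measurable_fun S (fun s : L => rearr h s).
  exact: measurable_rearr_within.
have mY : measurable_fun setT (fun x : L => excess c (g x)).
  by apply: measurable_excess; [exact: measurable_cst|exact: mg].
rewrite -integral_cst; last exact: mS.
case: (eqVneq c +oo) => [cy|cNy].
  rewrite [X in _ + X](_ : _ = 0); last first.
    by apply: integral0_eq => x _; rewrite cy excess_pinfty.
  rewrite adde0; apply: ge0_le_integral.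
  - exact: mS.
  - by move=> s _; exact: c0.
  - exact: measurable_cst.
  - exact: mr.
  - exact: cle.
have /fineK cE : c \is a fin_num by rewrite ge0_fin_numE// lt_neqAle cNy leey.
set Y := fun x : L => excess c (g x).
have Y0 x : 0 <= Y x by exact: excess_ge0.
(* Beyond [S], every level slightly above [c] is admissible for [g], hence the
   rearrangement of the excess vanishes there and its integral over the
   half-line reduces to [S]. *)
have Yoff s : (0 < s)%R -> ~ S s -> rearr Y s = 0.
  move=> s0 nSs; apply/eqP; rewrite eq_le rearr_ge0 andbT.
  apply/lee_addgt0Pr => e e0; rewrite add0e.
  have : c < (fine c + e)%:E by rewrite -{1}cE lte_fin ltrDl.
  move/ereal_inf_lt => [_ [s' Ss' <-]] /rearr_ltP[l le ll].
  apply: rearr_le; apply: (@le_trans _ _ (s' : R)%:E); last first.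
    rewrite lee_fin leNgt; apply/negP => ss'; apply: nSs.
    by apply: (S_init s0 (ltW ss')).
  apply: le_trans ll; apply: le_leb => x /=.
  rewrite (gee0_abs (Y0 x)) (gee0_abs (g0 x)) /Y -cE => /(lt_excess (ltW e0)).
  by rewrite addrC; exact: lt_trans.
have -> : \int[leb]_x Y x = \int[leb]_(s in S) rearr Y s.
  rewrite -(integral_rearr mY Y0).
  rewrite integral_mkcond [RHS]integral_mkcond; apply: eq_integral => s _.
  rewrite !patchE; case: ifPn => s0; case: ifPn => Ss //.
    by apply: Yoff; [move: s0; rewrite inE|move: Ss; rewrite notin_setE].
  by move: s0; rewrite mem_set//; apply: S_pos; move: Ss; rewrite inE.
rewrite -ge0_integralD; first last.
- exact: mr.
- by move=> s _; exact: rearr_ge0.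
- exact: measurable_cst.
- by move=> s _; exact: c0.
- exact: mS.
apply: ge0_le_integral.
- exact: mS.
- by move=> s _; apply: adde_ge0; [exact: c0|exact: rearr_ge0].
- by apply: emeasurable_funD; [exact: measurable_cst|exact: mr].
- exact: mr.
move=> s Ss; apply: le_rearr => l ll.
have cl : (fine c <= l)%R.
  by rewrite -lee_fin cE (le_trans (cle _ Ss))// rearr_le.
rewrite /cst -cE addeC -leeBrDr// -EFinB; apply: rearr_le.
apply: le_trans ll; apply: le_leb => x /=.
rewrite (gee0_abs (Y0 x)) (gee0_abs (g0 x)) /Y -cE => /lt_excess.
by rewrite subr_ge0 subrK; exact.
Qed.

(** Minkowski's integral inequality for the functional [\int_S rearr]. *)
Lemma integral_rearr_minkowski (g : L * L -> \bar R) (w : L -> \bar R) :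
  measurable_fun setT g -> (forall z, 0 <= g z) ->
  (forall x s t : R, (s <= t)%R -> g (x, t) <= g (x, s)) ->
  measurable_fun setT w -> (forall t, 0 <= w t) ->
  \int[leb]_(s in S) rearr (fun x => \int[leb]_t (w t * g (x, t))) s <=
  \int[leb]_t (w t * \int[leb]_(s in S) rearr (fun x => g (x, t)) s).
Proof.
move=> mg g0 gd mw w0.
(* The optimal cut of [g (_, t)]; it is measurable because it decreases in [t]. *)
pose c (t : L) := ereal_inf [set rearr (fun x => g (x, t)) s | s in S].
have c0 t : 0 <= c t by apply: le_ereal_inf_tmp => _ [s _ <-]; exact: rearr_ge0.
have rd (s t t' : R) : (t <= t')%R ->
    rearr (fun x => g (x, t')) s <= rearr (fun x => g (x, t)) s.
  move=> tt'; apply: rearr_homo => x.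
  by rewrite (gee0_abs (g0 _)) (gee0_abs (g0 _)) gd.
have mc : measurable_fun setT c.
  apply: measurable_decreasing => t t' tt'.
  apply: le_ereal_inf_tmp => _ [s Ss <-].
  by apply: le_trans (rd _ _ _ tt'); apply: ereal_inf_lbound; exists s.
have mI : measurable_fun setT
    (fun t : L => \int[leb]_(s in S) rearr (fun x => g (x, t)) s).
  apply: measurable_decreasing => t t' tt'.
  apply: ge0_le_integral.
  - exact: mS.
  - by move=> s _; exact: rearr_ge0.
  - exact: measurable_rearr_within.
  - exact: measurable_rearr_within.
  - by move=> s _; exact: rd.
pose k (z : L * L) := w z.2 * excess (c z.2) (g z).
have mk : measurable_fun setT k.
  apply: emeasurable_funM; first exact: measurableT_comp.
  by apply: measurable_excess; [exact: measurableT_comp|exact: mg].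
have k0 z : 0 <= k z by apply: mule_ge0; [exact: w0|exact: excess_ge0].
have mgx x : measurable_fun setT (fun t : L => g (x, t)) by exact: measurableT_comp.
have mgt t : measurable_fun setT (fun x : L => g (x, t)) by exact: measurableT_comp.
have mkx x : measurable_fun setT (fun t : L => k (x, t)) by exact: measurableT_comp.
have wc0 t : 0 <= w t * c t by apply: mule_ge0.
have mwc : measurable_fun setT (fun t => w t * c t) by exact: emeasurable_funM.
have C0 : 0 <= \int[leb]_t (w t * c t) by apply: integral_ge0 => t _; exact: wc0.
have mX : measurable_fun setT (fun x : L => \int[leb]_t k (x, t)).
  exact: (@measurable_fun_fubini_tonelli_F _ _ L L R
    (@completed_lebesgue_measure R) k mk k0).
have mX' : measurable_fun setT (fun t : L => \int[leb]_x k (x, t)).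
  exact: (@measurable_fun_fubini_tonelli_G _ _ L L R
    (@completed_lebesgue_measure R) k mk k0).
have X0 x : 0 <= \int[leb]_t k (x, t) by apply: integral_ge0 => t _; exact: k0.
have X0' t : 0 <= \int[leb]_x k (x, t) by apply: integral_ge0 => x _; exact: k0.
apply: (le_trans (integral_rearr_le_add C0 mX X0 _ _)).
- by move=> x; apply: integral_ge0 => t _; apply: mule_ge0; [exact: w0|exact: g0].
- move=> x; rewrite -ge0_integralD; first last.
  + exact: mkx.
  + by move=> t _; exact: k0.
  + exact: mwc.
  + by move=> t _; exact: wc0.
  + exact: measurableT.
  apply: ge0_le_integral.
  + exact: measurableT.
  + by move=> t _; apply: mule_ge0; [exact: w0|exact: g0].
  + by apply: emeasurable_funM; [exact: mw|exact: mgx].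
  + by apply: emeasurable_funD; [exact: mwc|exact: mkx].
  + move=> t _; rewrite /k/= -ge0_muleDr; [|exact: c0|exact: excess_ge0].
    by apply: lee_wpmul2l; [exact: w0|exact: le_add_excess].
rewrite (@fubini_tonelli _ _ L L R (@completed_lebesgue_measure R)
  (@completed_lebesgue_measure R) k mk k0).
have mwcS : measurable_fun setT (fun t => w t * c t * leb S).
  by apply: emeasurable_funM; [exact: mwc|exact: measurable_cst].
have wcS0 t : 0 <= w t * c t * leb S by apply: mule_ge0; [exact: wc0|exact: measure_ge0].
rewrite -ge0_integralZr; first last.
- exact: measure_ge0.
- by move=> t _; exact: wc0.
- exact: mwc.
- exact: measurableT.
rewrite -ge0_integralD; first last.
- exact: mX'.
- by move=> t _; exact: X0'.
- exact: mwcS.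
- by move=> t _; exact: wcS0.
- exact: measurableT.
apply: ge0_le_integral.
- exact: measurableT.
- by move=> t _; apply: adde_ge0; [exact: wcS0|exact: X0'].
- by apply: emeasurable_funD; [exact: mwcS|exact: mX'].
- by apply: emeasurable_funM; [exact: mw|exact: mI].
move=> t _; rewrite /k/= ge0_integralZl; first last.
- exact: w0.
- by move=> x _; exact: excess_ge0.
- by apply: measurable_excess; [exact: measurable_cst|exact: mgt].
- exact: measurableT.
rewrite -muleA -ge0_muleDr; first last.
- by apply: integral_ge0 => x _; exact: excess_ge0.
- by apply: mule_ge0; [exact: c0|exact: measure_ge0].
apply: lee_wpmul2l; first exact: w0.
exact: excess_inf_le_integral_rearr.
Qed.

End initial_segment.

(** * Decreasing weights *)

Section decreasing_weight.
Context {R : realType}.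
Local Notation L := (lebesgueType R).
(** [U] is a weight on the half-line extended by 0 to the line. *)
Variable U : L -> \bar R.
Hypotheses (mU : measurable_fun setT U) (U0 : forall s, 0 <= U s).
Hypothesis U_off : forall s : R, (s <= 0)%R -> U s = 0.
Hypothesis U_decr : forall s t : R, (0 < s)%R -> (s <= t)%R -> U t <= U s.

(** The pairs [(s, l)] with [0 < l < U s], and the superlevel sets of [U] at
    positive levels; [level_set l] is empty when [l <= 0]. *)
Definition level_graph : set (L * L) :=
  [set w | (0 < (w.2 : R))%R /\ (w.2 : R)%:E < U w.1].

Definition level_set (l : L) : set L := [set s | level_graph (s, l)].

Lemma measurable_level_graph : measurable level_graph.
Proof.
have m2 : measurable_fun [set: L * L] (fun w : L * L => (w.2 : R)%:E).
  exact: (measurableT_comp (@measurable_lebesgue_EFin R)).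
apply: measurableI.
  rewrite -[X in measurable X]setTI.
  exact: (measurable_lte measurableT (@measurable_cst _ _ _ _ _ 0%:E) m2).
rewrite -[X in measurable X]setTI.
by apply: (measurable_lte measurableT m2); exact: measurableT_comp.
Qed.

Lemma measurable_level_set (l : L) : measurable (level_set l).
Proof.
have := measurable_ysection l measurable_level_graph; congr measurable.
by apply/seteqP; split => s; rewrite /ysection/= ?inE.
Qed.

Lemma level_set_pos (l : L) : level_set l `<=` pos_reals R.
Proof.
move=> s [l0 ls]; rewrite /pos_reals/= ltNge; apply/negP => /U_off Us.
by move: ls; rewrite Us lte_fin ltNge ltW.
Qed.

Lemma level_set_init (l : L) (s t : R) :
  (0 < s)%R -> (s <= t)%R -> level_set l t -> level_set l s.
Proof. by move=> s0 st [l0 lt]; split => //; exact: lt_le_trans lt (U_decr s0 st). Qed.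

Lemma integral_level_set (phi : L -> \bar R) (l : L) :
  \int[leb]_(s in level_set l) phi s =
  \int[leb]_s (phi s * (\1_level_graph (s, l))%:E).
Proof.
rewrite integral_mkcond; apply: eq_integral => s _; rewrite patchE indicE.
have -> : (s \in level_set l) = ((s, l) \in level_graph).
  by apply/idP/idP; rewrite !inE.
by case: (_ \in _); rewrite ?mule1 ?mule0.
Qed.

Lemma measurable_integral_level_set d (Z : measurableType d)
    (phi : Z * L -> \bar R) : measurable_fun setT phi -> (forall z, 0 <= phi z) ->
  measurable_fun [set: Z * L]
    (fun zl : Z * L => \int[leb]_(s in level_set zl.2) phi (zl.1, s)).
Proof.
move=> mphi phi0.
pose k (w : (Z * L) * L) := phi (w.1.1, w.2) * (\1_level_graph (w.2, w.1.2))%:E.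
have mk : measurable_fun setT k.
  apply: emeasurable_funM.
    apply: (measurableT_comp mphi); apply: measurable_fun_pair.
      exact: measurableT_comp.
    exact: measurable_snd.
  apply/measurable_EFinP.
  apply: (measurableT_comp (measurable_indic measurable_level_graph)).
  apply: measurable_fun_pair; first exact: measurable_snd.
  exact: measurableT_comp.
have k0 w : 0 <= k w by rewrite mule_ge0.
under eq_fun do rewrite integral_level_set.
exact: (@measurable_fun_fubini_tonelli_F _ _ (Z * L)%type L R
  (@completed_lebesgue_measure R) k mk k0).
Qed.

Lemma integral_weight_layers (phi : L -> \bar R) :
  measurable_fun setT phi -> (forall s, 0 <= phi s) ->
  \int[leb]_s (phi s * U s) = \int[leb]_l \int[leb]_(s in level_set l) phi s.
Proof.
move=> mphi phi0.
pose k (w : L * L) := phi w.1 * (\1_level_graph w)%:E.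
have mk : measurable_fun setT k.
  apply: emeasurable_funM; first exact: measurableT_comp.
  apply/measurable_EFinP.
  exact: (measurable_indic measurable_level_graph).
have k0 w : 0 <= k w by rewrite mule_ge0.
transitivity (\int[leb]_s \int[leb]_l k (s, l)).
  apply: eq_integral => s _; rewrite /k/= ge0_integralZl//.
    congr (_ * _); rewrite -[LHS]leb_levels_lt//.
    rewrite -[LHS]mul1e -integral_cst; last first.
      have := measurable_xsection s measurable_level_graph; congr measurable.
      by apply/seteqP; split => l; rewrite /xsection/= ?inE.
    rewrite integral_mkcond; apply: eq_integral => l _.
    rewrite patchE indicE.
    case: ifPn => H.
      by rewrite mem_set//; move: H; rewrite inE.
    by rewrite memNset//; move: H; rewrite notin_setE.
  apply/measurable_EFinP.
  exact: (measurableT_comp (measurable_indic measurable_level_graph)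
    (pair1_measurable s)).
rewrite (@fubini_tonelli _ _ L L R (@completed_lebesgue_measure R)
  (@completed_lebesgue_measure R) k mk k0).
by apply: eq_integral => l _; rewrite integral_level_set.
Qed.

(** Minkowski's integral inequality for the functional [\int rearr * U]: the
    inequality on each superlevel set of [U] is integrated over the levels. *)
Lemma weighted_rearr_minkowski (g : L * L -> \bar R) (w : L -> \bar R) :
  measurable_fun setT g -> (forall z, 0 <= g z) ->
  (forall x s t : R, (s <= t)%R -> g (x, t) <= g (x, s)) ->
  measurable_fun setT w -> (forall t, 0 <= w t) ->
  \int[leb]_s (rearr (fun x => \int[leb]_t (w t * g (x, t))) s * U s) <=
  \int[leb]_t (w t * \int[leb]_s (rearr (fun x => g (x, t)) s * U s)).
Proof.
move=> mg g0 gd mw w0.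
pose gr (z : L * L) := rearr (fun x => g (x, z.1)) z.2.
have mgr : measurable_fun setT gr.
  apply: (@measurable_rearr_parametric _ L R (fun (t : L) (x : R) => g (x, t))).
  by move=> l; exact: measurable_section_distr.
have gr0 z : 0 <= gr z by exact: rearr_ge0.
pose k (tl : L * L) := w tl.1 * \int[leb]_(s in level_set tl.2) gr (tl.1, s).
have mI := measurable_integral_level_set mgr gr0.
have mk : measurable_fun setT k.
  by apply: emeasurable_funM; [exact: measurableT_comp|exact: mI].
have I0 l t : 0 <= \int[leb]_(s in level_set l) gr (t, s).
  by apply: integral_ge0 => s _; exact: gr0.
have k0 z : 0 <= k z by apply: mule_ge0; [exact: w0|exact: I0].
rewrite integral_weight_layers; first last.
- by move=> s; exact: rearr_ge0.
- exact: measurable_rearr.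
have -> : \int[leb]_t (w t * \int[leb]_s (rearr (fun x => g (x, t)) s * U s)) =
    \int[leb]_t \int[leb]_l k (t, l).
  apply: eq_integral => t _; rewrite /k/= ge0_integralZl; first last.
  - exact: w0.
  - by move=> l _; exact: I0.
  - exact: (measurableT_comp mI (pair1_measurable t)).
  - exact: measurableT.
  congr (_ * _); rewrite integral_weight_layers//.
    exact: measurable_rearr.
  by move=> s; exact: rearr_ge0.
rewrite (@fubini_tonelli _ _ L L R (@completed_lebesgue_measure R)
  (@completed_lebesgue_measure R) k mk k0).
apply: ge0_le_integral.
- exact: measurableT.
- by move=> l _; apply: integral_ge0 => s _; exact: rearr_ge0.
- set h := rearr _.
  have mh : measurable_fun setT (fun z : L * L => h z.2).
    exact: (measurableT_comp (measurable_rearr _)).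
  have := measurable_integral_level_set mh (fun z => rearr_ge0 _ _).
  by move=> /measurableT_comp/(_ (pair1_measurable point)); exact.
- exact: (@measurable_fun_fubini_tonelli_G _ _ L L R
    (@completed_lebesgue_measure R) k mk k0).
move=> l _; apply: integral_rearr_minkowski => //.
- exact: measurable_level_set.
- exact: level_set_pos.
- exact: level_set_init.
Qed.

End decreasing_weight.

(** * Lebesgue measurable functions on the plane *)

(** For almost every [x], the rearrangement of [f (x, _)] is determined by a
    sequence of measurable functions of [x]: the values of the distribution
    functions at the rational levels. *)
Lemma rearr_y_rat (R : realType) (f : R * R -> R) : lebesgue_measurable2 f ->
  exists (E : set R) (a : nat -> lebesgueType R -> \bar R),
    [/\ leb E = 0, forall n, measurable_fun setT (a n) &
      forall x t, ~ E x -> rearr_y f x t = rat_rearr (a^~ x) t].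
Proof.
move=> mf; pose mu := @lebesgue_measure R.
(* [A] is a Borel version of the superlevel set and [M] a Borel null set off
   which the two agree. *)
have split_level (n : nat) : exists AM : set (R * R) * set (R * R),
    [/\ measurable AM.1, measurable AM.2, (mu \x mu) AM.2 = 0 &
      forall z, ~ AM.2 z -> ((rat_level R n)%:E < `|(f z)%:E|) <-> AM.1 z].
  pose B := [set r : R | (rat_level R n)%:E < `|r%:E|].
  have mB : measurable B.
    rewrite -[B]setTI; apply: measurable_lte.
    - exact: measurableT.
    - exact: measurable_cst.
    - exact: (measurableT_comp (@abse_measurable R setT) (@EFin_measurable R setT)).
  have [A mA [N [M [mM M0 NM]] AN]] := mf _ mB.
  exists (A, M); split => // z nMz.
  have -> : ((rat_level R n)%:E < `|(f z)%:E|) = ((f @^-1` B) z) :> Prop by [].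
  rewrite -AN; split => [[//|/NM]//|Az]; by left.
have [AM AMP] := choice split_level.
have mx n : measurable_fun setT (mu \o xsection (AM n).2).
  by apply: measurable_fun_xsection; have [] := AMP n.
have : \forall x \ae mu, forall n, mu (xsection (AM n).2 x) = 0.
  apply/ae_foralln => n.
  have [_ _ + _] := AMP n; rewrite /product_measure1 => AM0.
  have /(ae_eq_integral_abs mu measurableT (mx n)) :
      \int[mu]_x `|(mu \o xsection (AM n).2) x| = 0.
    by rewrite -[RHS]AM0; apply: eq_integral => x _; rewrite gee0_abs.
  by apply: filterS => x /= /(_ I).
move=> [E [mE E0 EP]].
exists E, (fun n (x : lebesgueType R) => mu (xsection (AM n).1 (x : R))).
split => [//|n|x t nEx].
  move=> _ Y mY; rewrite setTI; apply: borel_lebesgue_measurable.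
  rewrite -[X in measurable X]setTI.
  have [mA _ _ _] := AMP n.
  exact: (measurable_fun_xsection mu mA measurableT mY).
have Mx : forall n, mu (xsection (AM n).2 x) = 0.
  by apply: contrapT => H; apply: nEx; apply: EP.
rewrite /rearr_y rearr_rat; congr rat_rearr; apply/funext => n.
apply: (eq_leb_off_null (Mx n)) => y nMy.
have [_ _ _ AMf] := AMP n.
apply: (iff_trans (AMf (x, y) _)).
  by move=> Mxy; apply: nMy; rewrite /xsection/= inE.
by rewrite /xsection/= inE.
Qed.

(** * The inclusion *)

Theorem theorem2p5 (R : realType) (p : R) (u v : R -> R)
    (p_gt0 : (0 < p)%R) (wu : weight u) (wv : weight v)
    (u_decr : forall x y : R, (0 < x)%R -> (x <= y)%R -> (u y <= u x)%R) :
  (Lambda2 p u v `<=` Lambda_iter p u v)%classic.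
Proof.
move=> f [mf f_fin]; split=> //.
have pV0 : p^-1%R != 0%R by rewrite invr_eq0 gt_eqF.
move: f_fin; rewrite /norm_Lambda2 /norm_Lambda_iter => /(lty_poweRy pV0) f_fin.
apply: poweR_lty; apply: le_lt_trans f_fin.
have [mu0 u0 _] := wu; have [mv0 v0 _] := wv.
have [E [a [E0 ma fa]]] := rearr_y_rat mf.
(* The maximum with 0 makes the base of the power nonnegative also at the
   exceptional [x], so that [g] is decreasing in [t] everywhere. *)
pose g (z : lebesgueType R * lebesgueType R) :=
  maxe (rat_rearr (a^~ z.1) z.2) 0 `^ p.
have mg : measurable_fun setT g.
  apply: (measurableT_comp (measurable_poweR p)).
  by apply: measurable_maxe; [exact: measurable_rat_rearr|exact: measurable_cst].
have g0 z : 0 <= g z by exact: poweR_ge0.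
have gd (x s t : R) : (s <= t)%R -> g (x, t) <= g (x, s).
  move=> st; apply: gt0_ler_poweR; first exact: ltW.
  - by rewrite in_itv/= leey le_max lexx orbT.
  - by rewrite in_itv/= leey le_max lexx orbT.
  - by rewrite ge_max !le_max lexx orbT rat_rearr_decr.
have gE x t : ~ E x -> rearr_y f x t `^ p = g (x, t).
  by move=> nEx; rewrite fa// /g /= -fa//; congr (_ `^ _); rewrite max_l// rearr_ge0.
have rE (s t : R) : rearr_yx f s t `^ p = rearr (fun x : R => g (x, t)) s.
  transitivity (rearr (fun x : R => rearr_y f x t `^ p) s).
    apply: esym; rewrite /rearr_yx; apply: rearr_poweR; first exact: p_gt0.
    by move=> x; exact: rearr_ge0.
  by apply: (rearr_ae s E0) => x nEx; exact: gE.
(* Weights are extended by 0, so that all integrals are over the whole line. *)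
pose ext (w : R -> R) : lebesgueType R -> \bar R := (EFin \o w) \_ (pos_reals R).
have ext0 w : (forall x : R, 0 < x -> 0 <= w x)%R -> forall s, 0 <= ext w s.
  move=> w0 s; rewrite /ext patchE; case: ifPn => // s0.
  by rewrite lee_fin w0//; move: s0; rewrite inE.
have mext w : measurable_fun (pos_reals R) (w : lebesgueType R -> R) ->
    measurable_fun setT (ext w).
  move=> mw; apply/(measurable_restrictT _ (@measurable_pos_reals R)).
  exact/measurable_EFinP.
have int_ext w (phi : lebesgueType R -> \bar R) :
    \int[leb]_(s in pos_reals R) (phi s * (w (s : R))%:E) =
    \int[leb]_s (phi s * ext w s).
  rewrite integral_mkcond; apply: eq_integral => s _; rewrite /ext !patchE.
  by case: ifP => // _; rewrite mule0.
have U_off (s : R) : (s <= 0)%R -> ext u s = 0.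
  move=> s0; rewrite /ext patchE memNset//= /pos_reals/=.
  by apply/negP; rewrite -leNgt.
have U_decr (s t : R) : (0 < s)%R -> (s <= t)%R -> ext u t <= ext u s.
  move=> s0 st; rewrite /ext !patchE !mem_set//=; first by rewrite lee_fin u_decr.
  exact: lt_le_trans st.
pose G (x : lebesgueType R) := \int[leb]_t (ext v t * g (x, t)).
have -> : \int[leb]_(s in pos_reals R) (rearr (fun x : R =>
      \int[leb]_(t in pos_reals R) (rearr_y f x t `^ p * (v t)%:E)) s * (u s)%:E) =
    \int[leb]_s (rearr G s * ext u s).
  rewrite -(int_ext u (fun s => rearr G s)).
  apply: eq_integral => s _; apply: (congr1 (fun r => r * (u s)%:E)).
  apply: (rearr_ae _ E0) => x nEx.
  rewrite (int_ext v (fun t => rearr_y f x t `^ p)).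
  by apply: eq_integral => t _; rewrite muleC gE.
have -> : \int[leb]_(t in pos_reals R) \int[leb]_(s in pos_reals R)
      (rearr_yx f s t `^ p * (u s)%:E * (v t)%:E) =
    \int[leb]_t (ext v t * \int[leb]_s (rearr (fun x => g (x, t)) s * ext u s)).
  rewrite integral_mkcond; apply: eq_integral => t _.
  rewrite patchE /ext patchE; case: ifPn => t0; last by rewrite mul0e.
  have vt0 : 0 <= (v t)%:E by rewrite lee_fin; apply: v0; move: t0; rewrite inE.
  transitivity (\int[leb]_(s in pos_reals R)
      (rearr (fun x => g (x, t)) s * (u s)%:E * (v t)%:E)).
    by apply: eq_integral => s _; rewrite rE.
  rewrite ge0_integralZr; first last.
  - exact: vt0.
  - move=> s s0; apply: mule_ge0; first exact: rearr_ge0.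
    by rewrite lee_fin; apply: u0.
  - apply: emeasurable_funM; first exact: measurable_rearr_within.
    exact/measurable_EFinP.
  - exact: measurable_pos_reals.
  by rewrite muleC (int_ext u (fun s => rearr (fun x => g (x, t)) s)).
exact: (weighted_rearr_minkowski (mext _ mu0) (ext0 _ u0) U_off U_decr mg g0 gd
  (mext _ mv0) (ext0 _ v0)).
Qed.
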